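(* For twisted knot diagrams $K$ with an even number of bars, the polynomial $$T_e(K)=\sum_{c\in C_o^0(K)}w(c)\,s_0+\sum_{c\in C_o^1(K)}w(c)\,s_1+\sum_{c\in C_e(K)}w(c)\,t^{\mathrm{Ind}(c)}-w(K)$$ (in formal variables $s_0,s_1$ and $t^{g}$, $g\in\mathbb{Z}_{S(K)}$) is a twisted knot invariant, i.e. invariant under generalized Reidemeister moves and twisted Reidemeister moves.
   Context: A twisted knot diagram is a virtual knot diagram with finitely many bars on its edges; twisted moves: $\Omega_1^t$ (a bar passes through a virtual crossing), $\Omega_2^t$ (two adjacent bars cancel), $\Omega_3^t$ (a real crossing is replaced by the crossing with over/under exchanged and a bar added on each of its four adjacent semiarcs). With $2n$ bars cutting $K$ into consecutive edges $e_1,\dots,e_{2n}$, $s(e)=u_+(e)+o_-(e)-u_-(e)-o_+(e)$ where $o_\pm(e)$ (resp. $u_\pm(e)$) counts positive/negative crossings at which $e$ is the over- (resp. under-) strand, and $S(K)=\left|\sum_{i=1}^n s(e_{2i-1})-\sum_{i=1}^n s(e_{2i})\right|$ ($0$ if no bars); $S(K)$ is even; $\mathbb{Z}_0=\mathbb{Z}$. Colorings: labels in $\mathbb{Z}_{S(K)}$ on the segments between real crossings and bars such that at each real crossing, with $x$ the label of the under-strand segment to the right of the over-strand and $y$ the label of the over-strand segment to the right of the under-strand, the other under-segment is labeled $x+1$ and the other over-segment $y+1$; labels across a bar are negatives. For a coloring $F$, $\mathrm{Ind}_F(c)=y-x$. Each chord $c$ of the Gauss diagram splits the circle into two arcs;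 $c\in C_e(K)$ if both arcs contain an even number of bars, $c\in C_o(K)$ if both contain an odd number. For $c\in C_e(K)$, $\mathrm{Ind}(c):=\mathrm{Ind}_F(c)$ is independent of $F$; for $c\in C_o(K)$ the parity of $\mathrm{Ind}_F(c)$ is independent of $F$, and $C_o^0(K)$ (resp. $C_o^1(K)$) denotes those with even (resp. odd) index. $w(c)$ is the writhe and $w(K)=\sum_c w(c)$. *)

(* Defs.v *)
From HB Require Import structures.
From mathcomp Require Import all_boot all_order all_algebra.
Set Implicit Arguments. Unset Strict Implicit. Unset Printing Implicit Defensive.
Import Order.TTheory GRing.Theory Num.Theory.
Local Open Scope ring_scope.

(* An item met while travelling once along the (single) component of the knot:
   [None] = a bar, [Some (c, true)] = passing over at real crossing c,
   [Some (c, false)] = passing under at real crossing c.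
   Virtual crossings are invisible in Gauss diagrams. *)
Definition item := option (nat * bool).
Definition Bar : item := None.
Definition Pass (c : nat) (over : bool) : item := Some (c, over).

(* The Gauss word is read cyclically; [sgn c = true] means crossing c is positive. *)
Record diagram := Diagram { word : seq item; sgn : nat -> bool }.

Definition chords_of (w : seq item) : seq nat := undup [seq p.1 | p <- pmap id w].
Definition chords (K : diagram) : seq nat := chords_of (word K).

Definition nbars (K : diagram) : nat := count (pred1 Bar) (word K).

Definition wf (K : diagram) : Prop :=
  forall c, (count (pred1 (Pass c true)) (word K) <= 1)%N /\
            count (pred1 (Pass c true)) (word K) = count (pred1 (Pass c false)) (word K).

Definition wc (K : diagram) (c : nat) : int := if sgn K c then 1 else -1.
Definition writhe (K : diagram) : int := \sum_(c <- chords K) wc K c.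

Definition delta (K : diagram) (p : nat * bool) : int :=
  if p.2 then (if sgn K p.1 then -1 else 1) else (if sgn K p.1 then 1 else -1).

Definition s_edge (K : diagram) (e : seq item) : int :=
  \sum_(x <- e) (if x is Some p then delta K p else 0).

Fixpoint pieces (w : seq item) : seq (seq item) :=
  match w with
  | [::] => [:: [::]]
  | None :: w' => [::] :: pieces w'
  | Some x :: w' =>
      match pieces w' with
      | p :: ps => (Some x :: p) :: ps
      | [::] => [:: [:: Some x]]
      end
  end.

(* the edges e_1, ..., e_m (m = number of bars) cut out by the bars, in order;
   the last edge wraps around the starting point of the word *)
Definition edges (K : diagram) : seq (seq item) :=
  let ps := pieces (word K) in
  let m := nbars K in
  if m == 0%N then [::]
  else rcons (take m.-1 (behead ps)) (last [::] ps ++ head [::] ps).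

Definition S (K : diagram) : int :=
  if nbars K == 0%N then 0
  else `| \sum_(i < size (edges K)) (-1) ^+ i * s_edge K (nth [::] (edges K) i) |.

(* cyclic indexing of the segments: segment i lies right after item i,
   so item i goes from segment [prev i] to segment i *)
Definition prev (K : diagram) (i : nat) : nat :=
  if i == 0%N then (size (word K)).-1 else i.-1.

(* colorings with labels in Z_{S(K)} (represented by integers modulo S(K);
   modulo 0 means equality, i.e. Z_0 = Z).  At a positive crossing the
   under-segment to the right of the over-strand is the incoming one and the
   over-segment to the right of the under-strand is the outgoing one; at a
   negative crossing it is the opposite.  This gives: out = in + delta. *)
Definition coloring (K : diagram) (F : nat -> int) : Prop :=
  forall i, (i < size (word K))%N ->
    match nth Bar (word K) i with
    | None => (F i = - F (prev K i) %[mod S K])%Z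
    | Some p => (F i = F (prev K i) + delta K p %[mod S K])%Z
    end.

Definition pos_over (K : diagram) (c : nat) : nat := index (Pass c true) (word K).
Definition pos_under (K : diagram) (c : nat) : nat := index (Pass c false) (word K).

Definition IndF (K : diagram) (F : nat -> int) (c : nat) : int :=
  if sgn K c then F (pos_over K c) - F (prev K (pos_under K c))
  else F (prev K (pos_over K c)) - F (pos_under K c).

Definition bars_arc (K : diagram) (c : nat) : nat :=
  let i := minn (pos_over K c) (pos_under K c) in
  let j := maxn (pos_over K c) (pos_under K c) in
  count (pred1 Bar) (drop i (take j (word K))).

Definition in_Ce (K : diagram) (c : nat) : bool :=
  ~~ odd (bars_arc K c) && ~~ odd (nbars K - bars_arc K c).
Definition in_Co (K : diagram) (c : nat) : bool :=
  odd (bars_arc K c) && odd (nbars K - bars_arc K c).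

(* monomials of T_e: s_0, s_1, and t^g (g in Z_{S(K)}, represented by its
   canonical integer representative g %% S(K); t^0 = 1) *)
Inductive mono := Ms0 | Ms1 | Mt of int.

Definition Te (K : diagram) (F : nat -> int) (m : mono) : int :=
  match m with
  | Ms0 => \sum_(c <- chords K | in_Co K c && (2 %| IndF K F c)%Z) wc K c
  | Ms1 => \sum_(c <- chords K | in_Co K c && ~~ (2 %| IndF K F c)%Z) wc K c
  | Mt g => \sum_(c <- chords K | in_Ce K c && ((IndF K F c %% S K)%Z == g)) wc K c
            - (if g == 0 then writhe K else 0)
  end.

(* R3 blocks: chords a = T over M, b = T over B, c = M over B;
   tT : T meets a before b; tM : M meets a before c; tB : B meets b before c *)
Definition r3_block (a b c : nat) (tT tM tB : bool) (i : nat) : seq item :=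
  match i with
  | 0%N => if tT then [:: Pass a true; Pass b true] else [:: Pass b true; Pass a true]
  | 1%N => if tM then [:: Pass a false; Pass c true] else [:: Pass c true; Pass a false]
  | _ => if tB then [:: Pass b false; Pass c false] else [:: Pass c false; Pass b false]
  end.

Definition agree (K : diagram) (sg' : nat -> bool) : Prop :=
  forall c, c \in chords K -> sg' c = sgn K c.

(* One generalized/twisted Reidemeister move on Gauss diagrams with bars
   (virtual moves and Omega_1^t do not change the Gauss diagram). *)
Inductive move : diagram -> diagram -> Prop :=
  | mv_rot (w : seq item) sg n : move (Diagram w sg) (Diagram (rot n w) sg)
  | mv_R1 u v sg sg' c o :
      c \notin chords_of (u ++ v) -> agree (Diagram (u ++ v) sg) sg' ->
      move (Diagram (u ++ v) sg) (Diagram (u ++ [:: Pass c o; Pass c (~~ o)] ++ v) sg')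
  | mv_R2_par u v w sg sg' c d o :
      c \notin chords_of (u ++ v ++ w) -> d \notin chords_of (u ++ v ++ w) -> c != d ->
      sg' c != sg' d -> agree (Diagram (u ++ v ++ w) sg) sg' ->
      move (Diagram (u ++ v ++ w) sg)
           (Diagram (u ++ [:: Pass c o; Pass d o] ++ v ++ [:: Pass c (~~ o); Pass d (~~ o)] ++ w) sg')
  | mv_R2_anti u v w sg sg' c d o :
      c \notin chords_of (u ++ v ++ w) -> d \notin chords_of (u ++ v ++ w) -> c != d ->
      sg' c != sg' d -> agree (Diagram (u ++ v ++ w) sg) sg' ->
      move (Diagram (u ++ v ++ w) sg)
           (Diagram (u ++ [:: Pass c o; Pass d o] ++ v ++ [:: Pass d (~~ o); Pass c (~~ o)] ++ w) sg')
  | mv_R3 u v w x sg a b c tT tM tB i j k :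
      uniq [:: a; b; c] -> perm_eq [:: i; j; k] [:: 0%N; 1%N; 2%N] ->
      (tT == tM) = (sg b == sg c) -> (tT == tB) = (sg a == sg c) ->
      move (Diagram (u ++ r3_block a b c tT tM tB i ++ v ++ r3_block a b c tT tM tB j
                       ++ w ++ r3_block a b c tT tM tB k ++ x) sg)
           (Diagram (u ++ r3_block a b c (~~ tT) (~~ tM) (~~ tB) i ++ v
                       ++ r3_block a b c (~~ tT) (~~ tM) (~~ tB) j ++ w
                       ++ r3_block a b c (~~ tT) (~~ tM) (~~ tB) k ++ x) sg)
  | mv_T2 u v sg : move (Diagram (u ++ v) sg) (Diagram (u ++ [:: Bar; Bar] ++ v) sg)
  | mv_T3 u v w sg c o :
      move (Diagram (u ++ [:: Pass c o] ++ v ++ [:: Pass c (~~ o)] ++ w) sg)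
           (Diagram (u ++ [:: Bar; Pass c (~~ o); Bar] ++ v
                       ++ [:: Bar; Pass c o; Bar] ++ w) sg).

(* Main.v *)
Require Import Defs.
From HB Require Import structures.
From mathcomp Require Import all_boot all_order all_algebra.
From mathcomp Require Import zify ring.
Set Implicit Arguments. Unset Strict Implicit. Unset Printing Implicit Defensive.
Import Order.TTheory GRing.Theory Num.Theory.
Local Open Scope ring_scope.

(** A piece of the Gauss word sends the label [f] of the segment before it to
[(-1)^b (f + a)], where [b] is the parity of its number of bars and [a] is a
signed sum over its crossings. These pairs [(b, a)] multiply as in the infinite
dihedral group; the whole word has state [(0, N)] with [|N| = S(K)], and whether
a chord contributes to a given monomial depends only on the states of the
prefixes leading to its two endpoints, on its sign and on [N]. This dependence
is invariant under a common left translation and under adding multiples of [N],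
which gives independence of the coloring and of the base point. Every other move
replaces blocks of the word by blocks with the same state, so only the chords
inside the blocks need to be compared. *)

(** * States of words as elements of the infinite dihedral group *)

Definition state := (bool * int)%type.
Definition twist (b : bool) (a : int) : int := if b then - a else a.
(** The left factor acts first: applying [g], then [h], sends [f] to $(-1)^{b+b'}(f + a + (-1)^b
    a')$. *)
Definition smul (g h : state) : state := (g.1 (+) h.1, g.2 + twist g.1 h.2).
Definition wsign (s : bool) : int := if s then 1 else -1.
Definition dlt (sg : nat -> bool) (p : nat * bool) : int :=
  if p.2 then - wsign (sg p.1) else wsign (sg p.1).

Lemma smulA : associative smul.
Proof.
move=> [[] a] [[] b] [[] c]; rewrite /smul /twist /=; congr (_, _); lia.
Qed.
Lemma smul1 g : smul (false, 0) g = g.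
Proof. by case: g => [b a]; rewrite /smul /= add0r. Qed.
Lemma smulr1 g : smul g (false, 0) = g.
Proof. by case: g => [[] a]; rewrite /smul /= ?oppr0 addr0. Qed.

Definition it (sg : nat -> bool) (x : item) : state :=
  if x is Some p then (false, dlt sg p) else (true, 0).
Fixpoint st sg (w : seq item) : state :=
  if w is x :: w' then smul (it sg x) (st sg w') else (false, 0).
(** State of the prefix before the first occurrence of [x]; if [x] is absent, the state of the whole
    word. *)
Fixpoint pst sg (w : seq item) (x : item) : state :=
  if w is y :: w' then if y == x then (false, 0) else smul (it sg y) (pst sg w' x)
  else (false, 0).

Lemma st_cat sg u v : st sg (u ++ v) = smul (st sg u) (st sg v).
Proof. by elim: u => [|x u IH] /=; rewrite ?smul1 // IH smulA. Qed.

Lemma pst_cat sg u v x :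
  pst sg (u ++ v) x = if x \in u then pst sg u x else smul (st sg u) (pst sg v x).
Proof.
elim: u => [|y u IH] /=; first by rewrite smul1.
rewrite inE eq_sym; case: eqP => //= _; rewrite IH.
by case: (x \in u); rewrite // smulA.
Qed.

Lemma pst_repl sg u B B' v x : st sg B = st sg B' -> x \notin B -> x \notin B' ->
  pst sg (u ++ B ++ v) x = pst sg (u ++ B' ++ v) x.
Proof.
by move=> eB /negPf xB /negPf xB'; rewrite !pst_cat xB xB' eB.
Qed.

(** Since [x] occurs at most once, its occurrence in [B] rules out an earlier one in [p]. *)
Lemma pst_block sg p B q x : (count (pred1 x) (p ++ B ++ q) <= 1)%N -> x \in B ->
  pst sg (p ++ B ++ q) x = smul (st sg p) (pst sg B x).
Proof.
rewrite !count_cat => cnt xB.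
have : (0 < count (pred1 x) B)%N by rewrite -has_count has_pred1.
move=> B0; rewrite !pst_cat xB; case: ifP => //.
by rewrite -has_pred1 has_count; lia.
Qed.

(* [g] and [h] are the states of the prefixes before the over- and the
   under-passage of a chord of sign [s]; for [g.1 = h.1] the index is
   [twist g.1 (g.2 - h.2) - wsign s] modulo [N]. *)
Definition chi (N : int) (s : bool) (g h : state) (m : mono) : bool :=
  match m with
  | Ms0 => (g.1 != h.1) && (2 %| g.2 + h.2 + 1)%Z
  | Ms1 => (g.1 != h.1) && ~~ (2 %| g.2 + h.2 + 1)%Z
  | Mt k => (g.1 == h.1) && ((twist g.1 (g.2 - h.2) - wsign s) %% N == k)%Z
  end.

(** * Symmetries of the test [chi] *)

Lemma chi_mul N s k g h m : chi N s (smul k g) (smul k h) m = chi N s g h m.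
Proof.
have par : (2 %| (smul k g).2 + (smul k h).2 + 1)%Z = (2 %| g.2 + h.2 + 1)%Z.
  by rewrite /smul /twist /=; case: k.1; lia.
case: m => [||j]; rewrite /chi ?par.
- by congr (_ && _); case: k g h {par} => [[] ?] [[] ?] [[] ?].
- by congr (_ && _); case: k g h {par} => [[] ?] [[] ?] [[] ?].
congr (_ && _); first by case: k g h {par} => [[] ?] [[] ?] [[] ?].
have -> : twist (smul k g).1 ((smul k g).2 - (smul k h).2) = twist g.1 (g.2 - h.2).
  by rewrite /smul /twist; case: k g h {par} => [[] ?] [[] ?] [[] ?] /=; lia.
by [].
Qed.

(** For endpoints of equal bar parity the twists of the offsets cancel, so the index sees only
    [x - y - wsign s]. Otherwise only the parity of [x + y] matters, and that is determined by the
    same number because [wsign] is odd. *)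
Lemma chi_block N s s' g h x y x' y' m :
  x - y - wsign s = x' - y' - wsign s' ->
  chi N s (smul g (false, x)) (smul h (false, y)) m
  = chi N s' (smul g (false, x')) (smul h (false, y')) m.
Proof.
move=> E.
case: m g h => [||j] [[] a] [[] b]; rewrite /chi /smul /twist /= //.
all: try by move: E; rewrite /wsign; case: s; case: s'; lia.
all: congr (modz _ _ == _); lia.
Qed.

(** Exchanging over and under negates the difference of the two states; a bar before each endpoint
    negates it back. *)
Lemma chi_swap N s g h m :
  chi N s (smul h (true, 0)) (smul g (true, 0)) m = chi N s g h m.
Proof.
case: m g h => [||j] [[] a] [[] b]; rewrite /chi /smul /twist /= //.
all: try lia.
all: congr (modz _ _ == _); lia.
Qed.

(** The two endpoints may be shifted by different multiples of [N]: the index is read modulo [N],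
    and evenness of [N] protects the parity tests. *)
Lemma chi_shift N s g h q r m : (2 %| N)%Z ->
  chi N s (smul (false, q * N) g) (smul (false, r * N) h) m = chi N s g h m.
Proof.
move=> /dvdzP [n ->].
case: m g h => [||j] [[] a] [[] b]; rewrite /chi /smul /twist /= //.
1-4: have -> : q * (n * 2) + a + (r * (n * 2) + b) + 1
    = a + b + 1 + (q * n + r * n) * 2 by ring.
1-4: by lia.
- have -> : - (q * (n * 2) + a - (r * (n * 2) + b)) - wsign s
    = (r - q) * (n * 2) + (- (a - b) - wsign s) by ring.
  by rewrite modzMDl.
- have -> : (q * (n * 2) + a - (r * (n * 2) + b)) - wsign s
    = (q - r) * (n * 2) + ((a - b) - wsign s) by ring.
  by rewrite modzMDl.
Qed.

(** * Sums over chords and their comparison between two words *)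

Definition unit_mono (m : mono) : bool := if m is Mt k then k == 0 else false.
Definition chord_chi sg w m c : bool :=
  chi (st sg w).2 (sg c) (pst sg w (Pass c true)) (pst sg w (Pass c false)) m.
(** The term $-w(K)$ is distributed over the chords, so that a chord contributing exactly to $t^0$
    adds zero to every coefficient. *)
Definition chord_sum sg w m : int :=
  \sum_(c <- chords_of w) wsign (sg c) * ((chord_chi sg w m c)%:R - (unit_mono m)%:R).

Lemma eq_Pass c b d b' : (Pass c b == Pass d b') = (c == d) && (b == b').
Proof. by []. Qed.

Lemma mem_chords w c : (c \in chords_of w) = (Pass c true \in w) || (Pass c false \in w).
Proof.
rewrite /chords_of mem_undup; elim: w => [|[[d b]|] w IH] //=; rewrite !inE IH.
by rewrite !eq_Pass; case: (c == d); case: b; rewrite ?orbT.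
Qed.

Lemma wf_count K x : wf K -> x != Bar -> (count (pred1 x) (word K) <= 1)%N.
Proof.
move=> wfK; case: x => [[c b]|] // _.
by have [le1 eqn] := wfK c; case: b; rewrite -?eqn.
Qed.

Lemma st_agree sg sg' w : {in chords_of w, sg' =1 sg} -> st sg' w = st sg w.
Proof.
elim: w => [|x w IH] //= eqs; rewrite IH; last first.
  by move=> c; rewrite mem_chords => cw; apply: eqs; rewrite mem_chords !inE;
      case/orP: cw => ->; rewrite ?orbT.
case: x eqs => [[c b]|] //= eqs; rewrite /dlt /= eqs // mem_chords !inE.
by case: b {eqs}; rewrite eqxx ?orbT.
Qed.

Lemma pst_agree sg sg' w x : {in chords_of w, sg' =1 sg} -> pst sg' w x = pst sg w x.
Proof.
elim: w => [|y w IH] //= eqs; case: eqP => // _; rewrite IH; last first.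
  by move=> c; rewrite mem_chords => cw; apply: eqs; rewrite mem_chords !inE;
      case/orP: cw => ->; rewrite ?orbT.
case: y eqs => [[c b]|] //= eqs; rewrite /dlt /= eqs // mem_chords !inE.
by case: b {eqs}; rewrite eqxx ?orbT.
Qed.

(** Needed because the first two Reidemeister moves fix the new sign function only on the old
    chords. *)
Lemma chord_sum_agree sg sg' w m : {in chords_of w, sg' =1 sg} ->
  chord_sum sg' w m = chord_sum sg w m.
Proof.
move=> eqs; rewrite /chord_sum !big_seq; apply: eq_bigr => c cw.
by rewrite /chord_chi (st_agree eqs) !(pst_agree _ eqs) eqs.
Qed.

(** Reduces a move to two checks: surviving chords pass the same tests, and the created chords
    cancel. *)
Lemma chord_sum_ext sg w w' new m :
  uniq new -> {in new, forall c, c \notin chords_of w} ->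
  chords_of w' =i chords_of w ++ new ->
  {in chords_of w, forall c, chord_chi sg w' m c = chord_chi sg w m c} ->
  \sum_(c <- new) wsign (sg c) * ((chord_chi sg w' m c)%:R - (unit_mono m)%:R) = 0 ->
  chord_sum sg w m = chord_sum sg w' m.
Proof.
move=> un dis mem eqc new0.
have pe : perm_eq (chords_of w') (chords_of w ++ new).
  apply: uniq_perm => //; first exact: undup_uniq.
  rewrite cat_uniq undup_uniq un andbT /=; apply/hasPn => c cn; exact: dis.
rewrite /chord_sum (perm_big _ pe) /= big_cat /= new0 addr0 !big_seq.
by apply: eq_bigr => c cw; rewrite eqc.
Qed.

Lemma wf_pst sg' K p B q x : wf K -> word K = p ++ B ++ q -> x != Bar -> x \in B ->
  pst sg' (word K) x = smul (st sg' p) (pst sg' B x).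
Proof.
by move=> wfK eqw xNB xB; rewrite eqw pst_block // -eqw wf_count.
Qed.

(** * Classical Reidemeister moves *)

Lemma st_pass2_cancel sg c d o : sg c != sg d ->
  st sg [:: Pass c o; Pass d o] = (false, 0).
Proof.
rewrite /= /smul /dlt /wsign /=.
by case: o; case: (sg c); case: (sg d).
Qed.

Lemma chord_sum_R1 sg u v c o m :
  wf (Diagram (u ++ [:: Pass c o; Pass c (~~ o)] ++ v) sg) ->
  c \notin chords_of (u ++ v) ->
  chord_sum sg (u ++ v) m = chord_sum sg (u ++ [:: Pass c o; Pass c (~~ o)] ++ v) m.
Proof.
set B := [:: _; _] => wfK cN.
have stB : st sg B = (false, 0).
  by rewrite /B /= /smul /dlt /wsign /=; case: o {B wfK}; case: (sg c).
apply: (chord_sum_ext (new := [:: c])) => //.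
- by move=> d; rewrite inE => /eqP ->.
- move=> d; rewrite mem_cat inE !mem_chords !mem_cat !inE.
  rewrite !eq_Pass; case: (d == c); rewrite /= ?orbF ?orbT //.
  by case: o {B wfK stB}; rewrite /= ?orbT.
- move=> d dN; have dc : d != c by apply: contraNneq cN => <-.
  rewrite /chord_chi !st_cat stB smul1.
  have rp x : x \notin B -> pst sg (u ++ B ++ v) x = pst sg (u ++ v) x.
    by move=> xB; rewrite (@pst_repl sg u B [::]).
  by rewrite !rp // !inE !eq_Pass (negPf dc).
rewrite big_seq1 /chord_chi.
have p1 b : pst sg (u ++ B ++ v) (Pass c b) = smul (st sg u) (pst sg B (Pass c b)).
  apply: (wf_pst sg wfK) => //; rewrite !inE.
  by rewrite !eq_Pass eqxx; case: o {B wfK stB}; case: b.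
(* The kink has no bar between its endpoints, and the offset of its second passage compensates its
   sign, so its index is zero. *)
have -> : chi (st sg (u ++ B ++ v)).2 (sg c) (pst sg (u ++ B ++ v) (Pass c true))
    (pst sg (u ++ B ++ v) (Pass c false)) m = unit_mono m.
  rewrite !p1 chi_mul /B; clear.
  rewrite /= !eq_Pass eqxx /=; case: o; rewrite /= /smul /dlt /=; case: m => [||k] //=.
    rewrite [X in (X %% _)%Z](_ : _ = 0) ?mod0z 1?eq_sym //.
    by rewrite /wsign; case: (sg c).
  rewrite [X in (X %% _)%Z](_ : _ = 0) ?mod0z 1?eq_sym //.
  by rewrite /wsign; case: (sg c).
by rewrite subrr mulr0.
Qed.

(** The two new chords pass the same tests and have opposite signs. The flag [r] distinguishes
    parallel from antiparallel strands. *)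
Lemma chord_sum_R2 sg u v w c d o (r : bool) m :
  let B := [:: Pass c o; Pass d o] in
  let B2 := if r then [:: Pass c (~~ o); Pass d (~~ o)]
            else [:: Pass d (~~ o); Pass c (~~ o)] in
  wf (Diagram (u ++ B ++ v ++ B2 ++ w) sg) ->
  c \notin chords_of (u ++ v ++ w) -> d \notin chords_of (u ++ v ++ w) ->
  c != d -> sg c != sg d ->
  chord_sum sg (u ++ v ++ w) m = chord_sum sg (u ++ B ++ v ++ B2 ++ w) m.
Proof.
move=> B B2 wfK cN dN cd scd.
have dc : (d == c) = false by rewrite eq_sym (negPf cd).
have stB : st sg B = (false, 0) by apply: st_pass2_cancel.
have stB2 : st sg B2 = (false, 0).
  by rewrite /B2; case: r {B2 wfK}; apply: st_pass2_cancel; rewrite // eq_sym.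
have memB e b : (Pass e b \in B) = ((e == c) || (e == d)) && (b == o).
  by rewrite !inE !eq_Pass andb_orl.
have memB2 e b : (Pass e b \in B2) = ((e == c) || (e == d)) && (b == ~~ o).
  by rewrite /B2; case: r {B2 wfK stB2}; rewrite !inE !eq_Pass andb_orl // orbC.
apply: (chord_sum_ext (new := [:: c; d])).
- by rewrite /= inE cd.
- by move=> e; rewrite !inE => /orP[] /eqP ->.
- move=> e; rewrite !mem_cat !mem_chords !mem_cat !memB !memB2 !inE.
  case: ((e == c) || (e == d)); rewrite /= ?orbF ?orbT //.
  by case: o {B B2 wfK stB stB2 memB memB2}; rewrite /= ?orbT.
- move=> e eN.
  have ec : (e == c) || (e == d) = false.
    by apply/negP => /orP[] /eqP E; move: eN; rewrite E ?(negPf cN) ?(negPf dN).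
  rewrite /chord_chi !st_cat stB stB2 !smul1.
  have rp b : pst sg (u ++ B ++ v ++ B2 ++ w) (Pass e b) = pst sg (u ++ v ++ w) (Pass e b).
    rewrite (@pst_repl sg u B [::]) ?memB ?ec //.
    by rewrite /= !(catA u) (@pst_repl sg (u ++ v) B2 [::]) ?memB2 ?ec.
  by rewrite !rp.
have p1 e : (e == c) || (e == d) ->
    pst sg (u ++ B ++ v ++ B2 ++ w) (Pass e o) = smul (st sg u) (pst sg B (Pass e o)).
  by move=> he; apply: (@wf_pst sg _ u B (v ++ B2 ++ w) _ wfK); rewrite ?memB ?he ?eqxx.
have p2 e : (e == c) || (e == d) -> pst sg (u ++ B ++ v ++ B2 ++ w) (Pass e (~~ o))
    = smul (st sg (u ++ B ++ v)) (pst sg B2 (Pass e (~~ o))).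
  move=> he; apply: (@wf_pst sg _ (u ++ B ++ v) B2 w _ wfK); rewrite ?memB2 ?he ?eqxx //=.
  by rewrite -!catA.
rewrite big_cons big_seq1.
(* The offsets inside the blocks compensate the opposite signs, so [x - y - wsign s] agrees for [c]
   and [d]. *)
have -> : chord_chi sg (u ++ B ++ v ++ B2 ++ w) m d
        = chord_chi sg (u ++ B ++ v ++ B2 ++ w) m c.
  have Bc : pst sg B (Pass c o) = (false, 0) by rewrite /= eq_Pass !eqxx.
  have Bd : pst sg B (Pass d o) = (false, dlt sg (c, o)).
    by rewrite /= !eq_Pass (negPf cd) !eqxx /= /smul /= addr0.
  have B2c : pst sg B2 (Pass c (~~ o)) = (false, if r then 0 else dlt sg (d, ~~ o)).
    by rewrite /B2; case: (r); rewrite /= !eq_Pass ?dc !eqxx //= /smul /= addr0.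
  have B2d : pst sg B2 (Pass d (~~ o)) = (false, if r then dlt sg (c, ~~ o) else 0).
    by rewrite /B2; case: (r); rewrite /= !eq_Pass ?(negPf cd) !eqxx //= /smul /= addr0.
  move: (p1 c) (p1 d) (p2 c) (p2 d); rewrite /chord_chi !eqxx ?orbT Bc Bd B2c B2d.
  move=> /(_ isT) + /(_ isT) + /(_ isT) + /(_ isT).
  move: (pst _ _) (st _ (u ++ _ ++ _ ++ _)).2 (st _ u) (st _ (u ++ _)) => P N g h.
  by clear -scd; case: o => /= -> -> -> ->; apply: chi_block; move: scd;
     rewrite /dlt /wsign /=; case: (r); case: (sg c); case: (sg d) => //= _; lia.
rewrite -mulrDl /wsign.
by move: scd; case: (sg c); case: (sg d); rewrite // mul0r.
Qed.

(** The blocks contain no bars, and states with bar parity [false] commute. *)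
Lemma st_r3 sg a b c tT tM tB i :
  st sg (r3_block a b c (~~ tT) (~~ tM) (~~ tB) i) = st sg (r3_block a b c tT tM tB i).
Proof.
by case: i => [|[|i]]; [case: tT|case: tM|case: tB]; rewrite /= /smul /= !addr0 addrC.
Qed.

Lemma notin_r3 e x a b c tT tM tB i : e \notin [:: a; b; c] ->
  Pass e x \notin r3_block a b c tT tM tB i.
Proof.
rewrite !inE; case: i => [|[|i]]; [case: tT|case: tM|case: tB];
by rewrite /= !inE !eq_Pass; case: (e == a); case: (e == b); case: (e == c).
Qed.

Lemma mem_r3_flip e x a b c tT tM tB i :
  (Pass e x \in r3_block a b c (~~ tT) (~~ tM) (~~ tB) i)
  = (Pass e x \in r3_block a b c tT tM tB i).
Proof.
by case: i => [|[|i]]; [case: tT|case: tM|case: tB]; rewrite /= !inE orbC.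
Qed.

(** Each of the three chords has its endpoints in two of the blocks. The sign conditions say that
    exchanging the letters shifts both endpoints by the same amount. *)
Lemma chord_sum_R3 sg u v w x a b c (tT tM tB : bool) i j k m :
  let W tT tM tB := u ++ r3_block a b c tT tM tB i ++ v ++ r3_block a b c tT tM tB j
                       ++ w ++ r3_block a b c tT tM tB k ++ x in
  uniq [:: a; b; c] -> perm_eq [:: i; j; k] [:: 0%N; 1%N; 2%N] ->
  (tT == tM) = (sg b == sg c) -> (tT == tB) = (sg a == sg c) ->
  wf (Diagram (W tT tM tB) sg) -> wf (Diagram (W (~~ tT) (~~ tM) (~~ tB)) sg) ->
  chord_sum sg (W tT tM tB) m = chord_sum sg (W (~~ tT) (~~ tM) (~~ tB)) m.
Proof.
move=> W uabc pe e1 e2 wfK wfK'.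
apply: (chord_sum_ext (new := [::])) => //.
- by move=> e; rewrite cats0 !mem_chords /W !mem_cat !mem_r3_flip.
- move=> e _; rewrite /chord_chi.
  have -> : st sg (W (~~ tT) (~~ tM) (~~ tB)) = st sg (W tT tM tB).
    by rewrite /W !st_cat !st_r3.
  case: (boolP (e \in [:: a; b; c])) => eabc; last first.
    have rp y : pst sg (W (~~ tT) (~~ tM) (~~ tB)) (Pass e y)
        = pst sg (W tT tM tB) (Pass e y).
      by rewrite /W !pst_cat !st_r3 !(negPf (notin_r3 _ _ _ _ _ eabc)).
    by rewrite !rp.
  (* Each block is preceded by the same state [g] in both words, as the earlier blocks have
     unchanged states. *)
  have pos t : t \in [:: i; j; k] -> exists g, forall e' y,
      Pass e' y \in r3_block a b c tT tM tB t ->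
      pst sg (W tT tM tB) (Pass e' y)
          = smul g (pst sg (r3_block a b c tT tM tB t) (Pass e' y)) /\
      pst sg (W (~~ tT) (~~ tM) (~~ tB)) (Pass e' y)
        = smul g (pst sg (r3_block a b c (~~ tT) (~~ tM) (~~ tB) t) (Pass e' y)).
    set A := r3_block a b c tT tM tB; set A' := r3_block a b c (~~ tT) (~~ tM) (~~ tB).
    rewrite !inE => /or3P[] /eqP ->.
    + exists (st sg u) => e' y ey; split; first by apply: (wf_pst _ wfK).
      by apply: (wf_pst _ wfK'); rewrite ?mem_r3_flip.
    + exists (st sg (u ++ A i ++ v)) => e' y ey; split.
        by apply: (wf_pst _ wfK); rewrite -?catA.
      have <- : st sg (u ++ A' i ++ v) = st sg (u ++ A i ++ v) by rewrite !st_cat st_r3.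
      by apply: (wf_pst _ wfK'); rewrite -?catA ?mem_r3_flip.
    + exists (st sg (u ++ A i ++ v ++ A j ++ w)) => e' y ey; split.
        by apply: (wf_pst _ wfK); rewrite -?catA.
      have <- : st sg (u ++ A' i ++ v ++ A' j ++ w) = st sg (u ++ A i ++ v ++ A j ++ w).
        by rewrite !st_cat !st_r3.
      by apply: (wf_pst _ wfK'); rewrite -?catA ?mem_r3_flip.
  have [gT HT] : exists g, _ := pos 0%N ltac:(by rewrite (perm_mem pe)).
  have [gM HM] : exists g, _ := pos 1%N ltac:(by rewrite (perm_mem pe)).
  have [gB HB] : exists g, _ := pos 2%N ltac:(by rewrite (perm_mem pe)).
  move: uabc; rewrite /= !inE negb_or -andbA => /and4P[ab ac bc _].
  have [ba ca cb] : [/\ (b == a) = false, (c == a) = false & (c == b) = false].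
    by rewrite ![_ == a]eq_sym [c == b]eq_sym (negPf ab) (negPf ac) (negPf bc).
  have eqs := (eq_Pass, ba, ca, cb, negPf ab, negPf ac, negPf bc, eqxx).
  have memT y z : Pass y z \in r3_block a b c tT tM tB 0 = ((y == a) || (y == b)) && z.
    by case: (tT); rewrite !inE !eqs andb_orl ?eqb_id // orbC.
  have memM : Pass a false \in r3_block a b c tT tM tB 1
      /\ Pass c true \in r3_block a b c tT tM tB 1.
    by case: (tM); rewrite !inE !eqs ?orbT.
  have memB : Pass b false \in r3_block a b c tT tM tB 2
      /\ Pass c false \in r3_block a b c tT tM tB 2.
    by case: (tB); rewrite !inE !eqs ?orbT.
  clear pos wfK wfK'.
  have calc g h X Y X' Y' : X.1 = false -> Y.1 = false -> X'.1 = false ->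
      Y'.1 = false -> X.2 - Y.2 = X'.2 - Y'.2 ->
    chi (st sg (W tT tM tB)).2 (sg e) (smul g X) (smul h Y) m =
    chi (st sg (W tT tM tB)).2 (sg e) (smul g X') (smul h Y') m.
    case: X Y X' Y' => [? ?] [? ?] [? ?] [? ?] /= -> -> -> -> E.
    by apply: chi_block; rewrite E.
  move: eabc; rewrite !inE => /or3P[] /eqP E; rewrite E in calc *.
  + have [-> ->] := HT a true ltac:(by rewrite memT eqxx).
    have [-> ->] := HM a false memM.1.
    apply: calc; move: e1; case: (tT); case: (tM);
        rewrite /= !eqs //= /smul /dlt /wsign /=; case: (sg b); case: (sg c) => //.
  + have [-> ->] := HT b true ltac:(by rewrite memT eqxx orbT).
    have [-> ->] := HB b false memB.1.
    apply: calc; move: e2; case: (tT); case: (tB);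
        rewrite /= !eqs //= /smul /dlt /wsign /=; case: (sg a); case: (sg c) => //.
  (* The relation required for [c], [(tM == tB) = (sg a == sg b)], follows from [e1] and [e2]
     together. *)
  + have [-> ->] := HM c true memM.2.
    have [-> ->] := HB c false memB.2.
    apply: calc; move: e1 e2; case: (tT); case: (tM); case: (tB);
        rewrite /= !eqs //= /smul /dlt /wsign /=; case: (sg a); case: (sg b);
        case: (sg c) => //.
by rewrite big_nil.
Qed.

(** * Twisted moves *)

Lemma chord_sum_T2 sg u v m :
  chord_sum sg (u ++ v) m = chord_sum sg (u ++ [:: Bar; Bar] ++ v) m.
Proof.
have stB : st sg [:: Bar; Bar] = (false, 0) by [].
apply: (chord_sum_ext (new := [::])) => //; last by rewrite big_nil.
- by move=> e; rewrite cats0 !mem_chords !mem_cat.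
- move=> e _; rewrite /chord_chi !(st_cat sg u) (st_cat sg [:: Bar; Bar]) stB smul1.
  by rewrite !(@pst_repl sg u [:: Bar; Bar] [::]).
Qed.

Lemma chord_sum_T3 sg u v w c o m :
  let W := u ++ [:: Pass c o] ++ v ++ [:: Pass c (~~ o)] ++ w in
  let W' := u ++ [:: Bar; Pass c (~~ o); Bar] ++ v ++ [:: Bar; Pass c o; Bar] ++ w in
  wf (Diagram W sg) -> wf (Diagram W' sg) -> chord_sum sg W m = chord_sum sg W' m.
Proof.
move=> W W' wfK wfK'.
(* Conjugation by a bar negates the translation of a passage, and so does exchanging over and
   under. *)
have stB b : st sg [:: Bar; Pass c (~~ b); Bar] = st sg [:: Pass c b].
  by rewrite /= /smul /dlt /wsign /=; case: b; case: (sg c).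
have stBn : st sg [:: Bar; Pass c o; Bar] = st sg [:: Pass c (~~ o)].
  by rewrite -stB negbK.
apply: (chord_sum_ext (new := [::])) => //; last by rewrite big_nil.
- move=> e; rewrite cats0 !mem_chords /W /W' !mem_cat !inE !eq_Pass /=.
  by case: (e == c); case: (o); rewrite /= ?orbT.
- move=> e _; rewrite /chord_chi.
  have -> : st sg W' = st sg W by rewrite /W /W' !st_cat stB stBn.
  case: (eqVneq e c) => [->|ec]; last first.
    have nB b b' : Pass e b' \notin [:: Bar; Pass c b;
        Bar] by rewrite !inE !eq_Pass (negPf ec).
    have n1 b b' : Pass e b' \notin [:: Pass c b] by rewrite !inE !eq_Pass (negPf ec).
    have rp b : pst sg W' (Pass e b) = pst sg W (Pass e b).
      by rewrite /W /W' !pst_cat stB stBn !(negPf (nB _ _)) !(negPf (n1 _ _)).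
    by rewrite !rp.
  (* For [c] itself the endpoint states [g] and [h] are exchanged and each is followed by a bar, as
     in [chi_swap]. *)
  pose g := st sg u; pose h := st sg (u ++ [:: Pass c o] ++ v).
  have hE : h = st sg (u ++ [:: Bar; Pass c (~~ o); Bar] ++ v) by rewrite /h !st_cat stB.
  have old1 : pst sg W (Pass c o) = g.
    by rewrite (@wf_pst sg _ u _ _ _ wfK erefl) ?inE //= eqxx smulr1.
  have old2 : pst sg W (Pass c (~~ o)) = h.
    rewrite (@wf_pst sg _ (u ++ [:: Pass c o] ++ v) [:: Pass c (~~ o)] w _ wfK)
        ?inE //= ?eqxx ?smulr1 //.
    by rewrite -!catA.
  have new1 : pst sg W' (Pass c (~~ o)) = smul g (true, 0).
    by rewrite (@wf_pst sg _ u _ _ _ wfK' erefl) ?inE ?eqxx ?orbT //= eqxx.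
  have new2 : pst sg W' (Pass c o) = smul h (true, 0).
    rewrite (@wf_pst sg _ (u ++ [:: Bar; Pass c (~~ o); Bar] ++ v) [:: Bar; Pass c o;
        Bar] w _ wfK') ?inE ?eqxx ?orbT //= ?eqxx -?hE //.
    by rewrite -!catA.
  move: old1 old2 new1 new2; case: (o) => /= -> -> -> ->; exact: chi_swap.
Qed.

(** * Parity of states and change of base point *)

Definition item_sum sg (w : seq item) : int :=
  \sum_(x <- w) (if x is Some p then dlt sg p else 0).

(* Bars only change signs, which is invisible modulo 2. *)
Lemma st_parity sg w : (2 %| (st sg w).2 - item_sum sg w)%Z.
Proof.
rewrite /item_sum; elim: w => [|x w]; first by rewrite big_nil.
by rewrite big_cons; case: x => [p|] /=; rewrite /smul /twist /=; lia.
Qed.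

Lemma st_nobar sg w : Bar \notin w -> (st sg w).2 = item_sum sg w.
Proof.
rewrite /item_sum; elim: w => [|[p|] w IH] //=; rewrite ?big_nil //.
by rewrite inE /= => /IH; rewrite /smul /= big_cons => ->.
Qed.

Lemma st_bar_parity sg w : (st sg w).1 = odd (count (pred1 Bar) w).
Proof.
elim: w => [|x w IH] //; rewrite [st _ _]/= [count _ _]/= oddD -IH /smul.
by case: x.
Qed.

Lemma wf_mem K c b : wf K -> (Pass c b \in word K) = (c \in chords K).
Proof.
move=> wfK; have [_ e] := wfK c; rewrite /chords mem_chords.
have -> : (Pass c true \in word K) = (Pass c false \in word K).
  by rewrite -!has_pred1 !has_count e.
by rewrite orbb; case: b => //; rewrite -!has_pred1 !has_count e.
Qed.

Lemma wf_item_sum sg K : wf K -> item_sum sg (word K) = 0.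
Proof.
move=> wfK.
have -> : item_sum sg (word K) = item_sum sg [seq x <- word K | x != Bar].
  by rewrite /item_sum big_filter [RHS]big_mkcond; apply: eq_bigr => -[].
(* Without its bars the word is a permutation of both passages of every chord, and these contribute
   opposite values. *)
rewrite /item_sum (perm_big ([seq Pass c true | c <- chords K] ++ [seq Pass c false | c <- chords K])) /=.
  by rewrite big_cat /= !big_map -big_split /= big1 // => c _; rewrite /dlt /= addNr.
apply: uniq_perm.
- apply: count_mem_uniq => x.
  have : (count_mem x [seq x <- word K | x != Bar] <= 1)%N.
    have [->|xB] := eqVneq x Bar; first by rewrite (count_memPn _) // mem_filter eqxx.
    apply: leq_trans (wf_count wfK xB); rewrite count_filter.
    by apply: sub_count => y /= /andP[].
  by rewrite -[x \in _]has_pred1 has_count; case: (count _ _) => [|[|]].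
- rewrite cat_uniq !map_inj_uniq ?undup_uniq ?andbT /=; try by move=> ? ? [].
  by apply/hasPn => _ /mapP[c _ ->]; apply/mapP => -[].
move=> x; rewrite mem_filter mem_cat.
case: x => [[c b]|]; last first.
  by symmetry; apply/negP => /orP[] /mapP[].
rewrite -/(Pass c b) wf_mem //=.
apply/idP/orP => [cK|].
  by case: b; [left|right]; apply/mapP; exists c.
by case=> /mapP[d dK [-> _]].
Qed.

(** For an even number of bars this is the evenness of $S(K)$. *)
Lemma wf_st_even sg K : wf K -> (2 %| (st sg (word K)).2)%Z.
Proof. by move=> /(wf_item_sum sg) e; move: (st_parity sg (word K)); rewrite e subr0. Qed.

(** With an even number of bars a full turn is the translation [(false, N)]. Moving the base point
    changes prefix states by a common left factor and such turns, which [chi_mul] and [chi_shift]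
    absorb. *)
Lemma chord_sum_rot sg w n m : wf (Diagram w sg) -> ~~ odd (count (pred1 Bar) w) ->
  chord_sum sg w m = chord_sum sg (rot n w) m.
Proof.
rewrite /rot -{1 2 3}(cat_take_drop n w); move: (take n w) (drop n w) => u v wfK ev.
apply: (chord_sum_ext (new := [::])) => //; last by rewrite big_nil.
  by move=> e; rewrite cats0 !mem_chords !mem_cat ![(_ \in v) || _]orbC orbACA.
move=> e ee; have ev2 := wf_st_even sg wfK.
rewrite -(st_bar_parity sg) in ev; rewrite /= in ev2.
set N := (st sg (u ++ v)).2 in ev2.
have mem b : (Pass e b \in u) = ~~ (Pass e b \in v).
  have := wf_count (x := Pass e b) wfK isT; rewrite /= count_cat.
  have := wf_mem e b wfK; rewrite /= [X in _ = X]ee mem_cat.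
  rewrite -![Pass e b \in _]has_pred1 !has_count.
  by case: (count _ u) (count _ v) => [|[|?]] [|[|?]].
have shift_by_N b : exists q, smul (st sg u) (pst sg (v ++ u) (Pass e b))
                = smul (false, q * N) (pst sg (u ++ v) (Pass e b)).
  rewrite !pst_cat mem; case: (Pass e b \in v) => /=.
    by exists 0; rewrite mul0r smul1.
  exists 1; rewrite mul1r smulA -st_cat; congr smul.
  by rewrite [LHS]surjective_pairing (negPf ev).
rewrite /chord_chi -(chi_mul _ _ (st sg u)).
have [q ->] := shift_by_N true; have [r ->] := shift_by_N false.
(* The rotated word has a conjugate state, hence $N$ or $-N$, and residues do not see the sign of
   the modulus. *)
have -> P Q : chi (st sg (v ++ u)).2 (sg e) P Q m = chi N (sg e) P Q m.
  have [->|->] : (st sg (v ++ u)).2 = N \/ (st sg (v ++ u)).2 = - N; [|by []|].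
    rewrite /N; move: ev; rewrite !st_cat /smul.
    case: (st sg u) (st sg v) => [[] x] [[] y] //= _; last by left; rewrite addrC.
    by right; rewrite opprB addrC.
  by case: m => [||k] //=; rewrite modzN.
exact: chi_shift.
Qed.

(** * $S(K)$ as the state of the whole word *)

Definition alt (l : seq int) : int := foldr (fun x y => x - y) 0 l.

Lemma alt_rcons l x : alt (rcons l x) = alt l + (-1) ^+ size l * x.
Proof.
elim: l => [|y l IH] /=; first by rewrite subr0 add0r mul1r.
by rewrite IH exprS opprD addrA mulN1r mulNr.
Qed.

Lemma alt_big T (x0 : T) (f : T -> int) l :
  \sum_(i < size l) (-1) ^+ i * f (nth x0 l i) = alt (map f l).
Proof.
elim: l => [|y l IH] /=; first by rewrite big_ord0.
rewrite big_ord_recl mul1r -IH -sumrN; congr (_ + _).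
by apply: eq_bigr => i _; rewrite /= exprS mulN1r mulNr.
Qed.

Lemma size_pieces w : size (pieces w) = (count (pred1 Bar) w).+1.
Proof.
elim: w => [|[p|] w IH] //=; last by rewrite IH.
by case: (pieces w) IH => [|q ps].
Qed.

Lemma s_edge_dlt K e : s_edge K e = item_sum (sgn K) e.
Proof. by rewrite /s_edge /item_sum; apply: eq_bigr => -[[c []]|] // _;
    rewrite /delta /dlt /wsign /=; case: (sgn K c). Qed.

(** Each bar negates everything after it, so the pieces enter with alternating signs. *)
Lemma st_pieces sg w : (st sg w).2 = alt (map (item_sum sg) (pieces w)).
Proof.
elim: w => [|[p|] w IH] /=.
- by rewrite /item_sum big_nil.
- case: (pieces w) (size_pieces w) IH => [|q ps] //= _ ->.
  by rewrite /item_sum big_cons addrA.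
- by rewrite /twist IH /item_sum big_nil.
Qed.

Lemma S_st K : wf K -> ~~ odd (nbars K) -> S K = `|(st (sgn K) (word K)).2|.
Proof.
move=> wfK ev; rewrite /S; case: eqP => [nb0|/eqP nb].
  (* Without bars $S(K)$ is zero by convention, and the state vanishes because the two passages of
     each chord cancel. *)
  rewrite st_nobar ?wf_item_sum ?normr0 //.
  by rewrite -has_pred1 has_count -/(nbars K) nb0.
rewrite alt_big st_pieces /edges (negPf nb).
have := size_pieces (word K); rewrite -/(nbars K).
rewrite (eq_map (s_edge_dlt K)).
case: (pieces (word K)) => [|h ps] // [sz].
case/lastP: ps sz => [sz|mid l]; first by rewrite -sz in nb.
rewrite size_rcons => sz; rewrite -sz /= in ev *; rewrite last_rcons.
have -> : take (size mid) (rcons mid l) = mid by rewrite -cats1 take_size_cat.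
rewrite !map_rcons !alt_rcons !size_map.
(* As the number of bars is even, the first and last pieces carry the same sign and can be glued
   into one edge. Numbering the edges from the second piece changes the overall sign, which the
   absolute value removes. *)
rewrite -signr_odd (negbNE ev) /item_sum big_cat /= !mulN1r.
by rewrite -normrN; congr (`| _ |); ring.
Qed.

(** * Colorings and the index of a chord *)

Lemma pst_take sg w x : pst sg w x = st sg (take (index x w) w).
Proof. by elim: w => [|y w IH] //=; case: eqP => //= _; rewrite IH. Qed.

(** Modulo $S(K)$ a coloring is determined by the label before the first item, on which the prefix
    states act. *)
Lemma coloring_st K F i : coloring K F -> (i < size (word K))%N ->
  exists q, let g := st (sgn K) (take i (word K)) in
    F (Defs.prev K i) = twist g.1 (F (Defs.prev K 0) + g.2) + q * S K.
Proof.
move=> col; elim: i => [|i IH] lt_i.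
  by exists 0; rewrite take0 /= mul0r !addr0.
have [q] := IH (ltnW lt_i); have := col i (ltnW lt_i).
rewrite (take_nth Bar) ?(ltnW lt_i) // -cats1 st_cat.
have -> : Defs.prev K i.+1 = i by [].
case: (nth _ _ _) => [[c b]|] /eqP; rewrite eqz_mod_dvd => /dvdzP[r] eqr /= eqq.
  have dE : delta K (c, b) = dlt (sgn K) (c, b).
    by rewrite /delta /dlt /wsign /=; case: b {eqr}; case: (sgn K c).
  exists (q + r); rewrite dE eqq in eqr; move/eqP: eqr; rewrite subr_eq => /eqP ->.
  rewrite /smul /twist /=; case: (st _ _).1 => /=; ring.
exists (r - q); rewrite eqq in eqr; move/eqP: eqr; rewrite subr_eq => /eqP ->.
rewrite /smul /twist /=; case: (st _ _).1 => /=; ring.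
Qed.

Definition mono_test K F c m : bool :=
  match m with
  | Ms0 => in_Co K c && (2 %| IndF K F c)%Z
  | Ms1 => in_Co K c && ~~ (2 %| IndF K F c)%Z
  | Mt k => in_Ce K c && ((IndF K F c %% S K)%Z == k)
  end.

(** [IndF] uses one incoming and one outgoing segment, chosen by the sign. One coloring step makes
    both incoming, at the cost of [- wsign] for either sign. *)
Lemma coloring_Ind K F c : coloring K F -> wf K -> c \in chords K ->
  let g := pst (sgn K) (word K) (Pass c true) in
  let h := pst (sgn K) (word K) (Pass c false) in
  exists q, IndF K F c
      = twist g.1 (F (Defs.prev K 0) + g.2) - twist h.1 (F (Defs.prev K 0) + h.2)
     - wsign (sgn K c) + q * S K.
Proof.
move=> col wfK cK /=.
have lt b : (index (Pass c b) (word K) < size (word K))%N by rewrite index_mem wf_mem.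
rewrite !pst_take.
have [q1 e1] := coloring_st col (lt true); have [q2 e2] := coloring_st col (lt false).
have := col _ (lt true); have := col _ (lt false); rewrite !nth_index ?wf_mem //=.
move=> /eqP + /eqP; rewrite !eqz_mod_dvd => /dvdzP[r2 d2] /dvdzP[r1 d1].
move: e1 e2 d1 d2; rewrite /= /IndF /delta /pos_over /pos_under /wsign /=.
move: (twist _ _) (twist _ _) => t1 t2 e1 e2; case: (sgn K c) => /eqP + /eqP;
    rewrite !subr_eq => /eqP d1 /eqP d2.
  by exists (q1 - q2 + r1); rewrite d1 e1 e2; ring.
by exists (q1 - q2 - r2); rewrite d2 e1 e2; ring.
Qed.

Lemma odd_bars_arc K c sg : odd (bars_arc K c) =
  (pst sg (word K) (Pass c true)).1 (+) (pst sg (word K) (Pass c false)).1.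
Proof.
rewrite !pst_take !st_bar_parity /bars_arc /pos_over /pos_under.
move: (index _ _) (index _ _) => j i.
wlog ij : i j / (i <= j)%N.
  move=> H; case/orP: (leq_total i j) => /H //; rewrite minnC maxnC => ->; exact: addbC.
rewrite (minn_idPl ij) (maxn_idPr ij).
have <- : take i (take j (word K)) = take i (word K) by rewrite take_takel.
rewrite -[in X in _ = _ (+) X](cat_take_drop i (take j (word K))) count_cat oddD.
by rewrite addKb.
Qed.

Lemma bars_arc_le K c : (bars_arc K c <= nbars K)%N.
Proof.
by apply: leq_count_subseq; apply: subseq_trans (drop_subseq _ _) (take_subseq _ _).
Qed.

Lemma mono_testE K F c m : wf K -> ~~ odd (nbars K) -> coloring K F -> c \in chords K ->
  mono_test K F c m = chord_chi (sgn K) (word K) m c.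
Proof.
move=> wfK ev col cK; have [q eq] := coloring_Ind col wfK cK.
have ar := odd_bars_arc K c (sgn K).
(* The total number of bars is even, so both arcs have the same parity. *)
have Ce : in_Ce K c = ~~ odd (bars_arc K c).
  by rewrite /in_Ce oddB ?bars_arc_le // (negPf ev) /= andbb.
have Co : in_Co K c = odd (bars_arc K c).
  by rewrite /in_Co oddB ?bars_arc_le // (negPf ev) /= andbb.
have SE := S_st wfK ev; have /dvdzP[n nE] := wf_st_even (sgn K) wfK.
have [n' S2] : exists n', S K = n' * 2 by exists `|n|; rewrite SE nE normrM.
rewrite /chord_chi /mono_test Ce Co ar.
move: (pst _ _ _) (pst _ _ _) eq => h g /= eq.
(* With opposite twists the initial label occurs doubled, so it disappears modulo 2, as do multiples
   of the even $S(K)$. *)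
have par : g.1 != h.1 -> (2 %| IndF K F c)%Z = (2 %| g.2 + h.2 + 1)%Z.
  by rewrite eq S2 /twist /wsign mulrA; move: (q * n'); case: g.1; case: h.1 => // z _;
      case: (sgn K c); lia.
case: m => [||k] /=; rewrite -?negb_eqb ?negbK.
- by case E: (g.1 != h.1) => //=; rewrite par ?E.
- by case E: (g.1 != h.1) => //=; rewrite par ?E.
(* With equal twists the initial label cancels. *)
case: eqP => //= gh; rewrite eq addrC modzMDl SE modz_abs.
by rewrite gh /twist; case: h.1; congr (modz _ _ == _); ring.
Qed.

(** The right side does not mention [F], so this includes independence of the coloring. *)
Lemma Te_chord_sum K F m : wf K -> ~~ odd (nbars K) -> coloring K F ->
  Te K F m = chord_sum (sgn K) (word K) m.
Proof.
move=> wfK ev col.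
have E : \sum_(c <- chords K | mono_test K F c m) wc K c =
    \sum_(c <- chords K) wsign (sgn K c) * (chord_chi (sgn K) (word K) m c)%:R.
  rewrite big_mkcond !big_seq; apply: eq_bigr => c cK; rewrite mono_testE //.
  by case: ifP; rewrite ?mulr0 ?mulr1.
rewrite /chord_sum; under eq_bigr do rewrite mulrBr.
rewrite sumrB -E; case: m {E} => [||k] /=; rewrite -mulr_suml ?mulr0 ?subr0 //.
by case: (k == 0); rewrite ?mulr1 ?mulr0.
Qed.

(** * Invariance under all moves *)

Lemma r3_block_bars a b c tT tM tB i :
  count (pred1 Bar) (r3_block a b c tT tM tB i) = 0%N.
Proof. by case: i => [|[|i]]; [case: tT|case: tM|case: tB]. Qed.

Lemma move_bars K K' : move K K' -> odd (nbars K) = odd (nbars K').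
Proof.
case=> *; rewrite /nbars /=; first by rewrite /rot count_cat addnC -count_cat cat_take_drop.
all: rewrite !count_cat ?r3_block_bars /= ?count_cat /=; lia.
Qed.

Lemma move_chord_sum K K' m : move K K' -> wf K -> wf K' -> ~~ odd (nbars K) ->
  chord_sum (sgn K) (word K) m = chord_sum (sgn K') (word K') m.
Proof.
case=> {K K'} /=.
- move=> w sg n wfK _ ev; exact: chord_sum_rot.
- move=> u v sg sg' c o cN ag _ wfK' _; rewrite -(chord_sum_agree _ ag);
    exact: chord_sum_R1.
- move=> u v w sg sg' c d o cN dN cd scd ag _ wfK' _.
  by rewrite -(chord_sum_agree _ ag); apply: (@chord_sum_R2 sg' u v w c d o true).
- move=> u v w sg sg' c d o cN dN cd scd ag _ wfK' _.
  by rewrite -(chord_sum_agree _ ag); apply: (@chord_sum_R2 sg' u v w c d o false).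
- move=> u v w x sg a b c tT tM tB i j k uabc pe e1 e2 wfK wfK' _.
  exact: chord_sum_R3.
- by move=> *; apply: chord_sum_T2.
- by move=> *; apply: chord_sum_T3.
Qed.

Theorem theorem7p8 (K K' : diagram) :
  wf K -> wf K' -> ~~ odd (nbars K) -> (move K K' \/ move K' K) ->
  forall (F F' : nat -> int), coloring K F -> coloring K' F' ->
  forall m : mono, Te K F m = Te K' F' m.
Proof.
move=> wfK wfK' ev mv F F' col col' m.
have ev' : ~~ odd (nbars K') by case: mv => /move_bars; [move <-|move ->].
rewrite !Te_chord_sum //; case: mv => mv; first exact: move_chord_sum.
by symmetry; apply: move_chord_sum.
Qed.
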